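(* Let $\gamma=\gamma(\nu_3)$ be an axially symmetric anisotropic energy density. Let $\omega, C\in\mathbf{R}$ be constants, let $(x(s),y(s))$, $s\in I$ ($I$ an open interval), be a smooth plane curve parameterized by arc length, and let $$X(s,\vartheta)=\bigl([x(s)+iy(s)]e^{-i\omega\vartheta},\ \vartheta+C\bigr),\qquad (s,\vartheta)\in I\times\mathbf{R},$$ where the $x_1x_2$-plane of $\mathbf{R}^3$ is identified with $\mathbf{C}$. Put $$\eta_1(s)=-\tfrac12\,\partial_s\bigl[x(s)^2+y(s)^2\bigr],\qquad \eta_2(s)=x\,y_s-y\,x_s .$$ Let $\Lambda\in\mathbf{R}$. Then the surface $X$ has constant anisotropic mean curvature $\Lambda$ if and only if there is a real constant $A$ such that, identically in $s$, $$\Lambda(\eta_1^2+\eta_2^2)+\frac{2\eta_2}{\mu_2\!\left(\frac{\omega\eta_1}{\sqrt{1+\omega^2\eta_1^2}}\right)\sqrt{1+\omega^2\eta_1^2}}+A\equiv 0 .$$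
   Context: An anisotropic energy density is a smooth function $\gamma:S^2\to\mathbf{R}$; it defines the functional $\mathcal{F}=\int_\Sigma\gamma(\nu)\,d\Sigma$ on smooth oriented immersed surfaces $X:\Sigma\to\mathbf{R}^3$ with unit normal $\nu=(\nu_1,\nu_2,\nu_3)$. Its Wulff shape is $W=\partial\bigcap_{n\in S^2}\{Y\in\mathbf{R}^3: Y\cdot n\le\gamma(n)\}$. It is assumed throughout that $W$ is a smooth convex surface with positive curvature, and that $\gamma$ is its support function. The density is axially symmetric if $\gamma$ depends only on $\nu_3$, written $\gamma=\gamma(\nu_3)$; then one sets $$\frac{1}{\mu_2(\nu_3)}=\gamma(\nu_3)-\nu_3\gamma'(\nu_3),\qquad \frac1{\mu_1(\nu_3)}=(1-\nu_3^2)\gamma''(\nu_3)+\frac{1}{\mu_2(\nu_3)} .$$ These $\mu_1,\mu_2$ are the principal curvatures of $W$ with respect to the inward normal, and both are positive. Let $\tilde\gamma(Y)=|Y|\gamma(Y/|Y|)$, $Y\ne0$. The Cahn-Hoffman field is $\xi_p=(\nabla\tilde\gamma)_{\nu(p)}$, and the anisotropic mean curvature is $\Lambda=-\mathrm{Div}\,\xi$, where $\mathrm{Div}$ is the surface divergence (the trace over the tangent plane of the differential of $\xi$). Equivalently, $\delta\mathcal{F}=-\int_\Sigma\Lambda\,\dot X\cdot\nu\,d\Sigma$ for compactly supported variations. Orientation: writing $x_s+iy_s=e^{i\phi(s)}$, the surface $X$ is oriented by $$\nu=\frac{\bigl(-i\,e^{i(\phi-\omega\vartheta)},\ \omega\eta_1\bigr)}{\sqrt{1+\omega^2\eta_1^2}},\qquad\text{so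 that}\quad \nu_3=\frac{\omega\eta_1}{\sqrt{1+\omega^2\eta_1^2}} .$$
   Formalization: The ''if'' direction is stated only when η1 is not identically zero on I: for an arc of a circle centred at the origin, η1≡0 and η2 is constant, so a suitable A exists for every Λ although the cylinder X has one fixed anisotropic mean curvature. *)

(* Defs.v *)
From HB Require Import structures.
From mathcomp Require Import all_boot all_order all_algebra.
From mathcomp Require Import all_classical all_reals all_analysis.
From mathcomp Require Import complex.

Set Implicit Arguments.
Unset Strict Implicit.
Unset Printing Implicit Defensive.

Import Order.TTheory GRing.Theory Num.Theory.
Import numFieldNormedType.Exports.

Local Open Scope ring_scope.
Local Open Scope classical_set_scope.
Local Open Scope complex_scope.

(* C^k on an open set U, by iterated directional derivatives. *)
Fixpoint Ck_on (R : realType) (V : normedModType R) (k : nat)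
    (U : set V) (f : V -> R) : Prop :=
  if k is k'.+1 then
    (forall p, U p -> differentiable f p) /\ (forall v, Ck_on k' U ('D_v f))
  else forall p, U p -> {for p, continuous f}.

Definition smooth_on (R : realType) (V : normedModType R)
    (U : set V) (f : V -> R) : Prop :=
  forall k, Ck_on k U f.

(* The library norm on 'rV[R]_3 is the sup norm, hence the separate
   Euclidean norm below. *)
Definition dot (R : realType) (u v : 'rV[R]_3) : R :=
  \sum_(i < 3) u 0 i * v 0 i.

Definition enorm (R : realType) (u : 'rV[R]_3) : R := Num.sqrt (dot u u).

Definition sphere2 (R : realType) : set 'rV[R]_3 := [set n | enorm n = 1].

Definition grad (R : realType) (f : 'rV[R]_3 -> R) (p : 'rV[R]_3) : 'rV[R]_3 :=
  \row_(i < 3) 'D_(delta_mx 0 i) f p.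

(* An energy density is represented by a function on R^3 of which only the
   values on the unit sphere matter; it is smooth on the sphere when it agrees
   there with a smooth function defined on a neighbourhood of the sphere. *)
Definition smooth_on_sphere (R : realType) (gamma : 'rV[R]_3 -> R) : Prop :=
  exists (U : set 'rV[R]_3) (F : 'rV[R]_3 -> R),
    [/\ open U, @sphere2 R `<=` U, smooth_on U F &
        forall n, sphere2 n -> F n = gamma n].

Definition wulff_body (R : realType) (gamma : 'rV[R]_3 -> R) : set 'rV[R]_3 :=
  [set Y | forall n, sphere2 n -> dot Y n <= gamma n].

Definition boundary (R : realType) (K : set 'rV[R]_3) : set 'rV[R]_3 :=
  closure K `\` interior K.

Definition wulff_shape (R : realType) (gamma : 'rV[R]_3 -> R) :
    set 'rV[R]_3 :=
  boundary (wulff_body gamma).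

(* Normal curvature at p, in the tangent direction v, of the level surface of F
   through p, with respect to the unit normal - grad F / |grad F|. *)
Definition normal_curvature (R : realType) (F : 'rV[R]_3 -> R)
    (p v : 'rV[R]_3) : R :=
  'D_v ('D_v F) p / (enorm (grad F p) * dot v v).

(* The boundary of K is a smooth surface, and K lies locally on the side F <= 0
   of it, so that - grad F is inward; all normal curvatures with respect to the
   inward normal (in particular the two principal ones) are positive. *)
Definition smooth_positively_curved_boundary (R : realType)
    (K : set 'rV[R]_3) : Prop :=
  forall p, boundary K p ->
    exists (U : set 'rV[R]_3) (F : 'rV[R]_3 -> R),
      [/\ open U /\ U p,
          smooth_on U F,
          K `&` U = [set Y | F Y <= 0] `&` U /\
            boundary K `&` U = [set Y | F Y = 0] `&` U,
          grad F p != 0 &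
          forall v, v != 0 -> dot (grad F p) v = 0 ->
            0 < normal_curvature F p v].

Definition is_support_function (R : realType) (W : set 'rV[R]_3)
    (gamma : 'rV[R]_3 -> R) : Prop :=
  W !=set0 /\ forall n, sphere2 n -> gamma n = sup [set dot Y n | Y in W].

(* The Wulff shape is convex because it bounds an intersection of half-spaces. *)
Definition anisotropic_density (R : realType) (gamma : 'rV[R]_3 -> R) : Prop :=
  [/\ smooth_on_sphere gamma,
      smooth_positively_curved_boundary (wulff_body gamma) &
      is_support_function (wulff_shape gamma) gamma].

(* gamma depends only on the third coordinate, through the profile g; only the
   values of g on [-1, 1] are meaningful. *)
Definition axially_symmetric (R : realType) (gamma : 'rV[R]_3 -> R)
    (g : R -> R) : Prop :=
  forall n, sphere2 n -> gamma n = g (n 0 ord_max).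

Definition mu2 (R : realType) (g : R -> R) (t : R) : R :=
  (g t - t * derive1 g t)^-1.

Definition homog_ext (R : realType) (gamma : 'rV[R]_3 -> R) (Y : 'rV[R]_3) : R :=
  enorm Y * gamma ((enorm Y)^-1 *: Y).

Definition cahn_hoffman (R : realType) (gamma : 'rV[R]_3 -> R)
    (nu : R -> R -> 'rV[R]_3) (s t : R) : 'rV[R]_3 :=
  grad (homog_ext gamma) (nu s t).

(* The rows are the two partial derivatives of a map from the plane to R^3. *)
Definition jac (R : realType) (X : R -> R -> 'rV[R]_3) (s t : R) :
    'M[R]_(1 + 1, 3) :=
  col_mx (derive1 (fun u => X u t) s) (derive1 (X s) t).

(* Trace over the tangent plane of the differential of xi along the
   parametrized immersion X: with X_i the coordinate tangent vectors,
   sum_{i,j} <d_i xi, X_j> g^{ji}, where g_{ij} = <X_i, X_j>. *)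
Definition surface_div (R : realType) (X xi : R -> R -> 'rV[R]_3) (s t : R) : R :=
  \tr ((jac xi s t *m (jac X s t)^T) *m invmx (jac X s t *m (jac X s t)^T)).

Definition aniso_mean_curvature (R : realType) (gamma : 'rV[R]_3 -> R)
    (X nu : R -> R -> 'rV[R]_3) (s t : R) : R :=
  - surface_div X (cahn_hoffman gamma nu) s t.

Definition vec3 (R : realType) (z : R[i]) (h : R) : 'rV[R]_3 :=
  \row_(i < 3) [:: complex.Re z; complex.Im z; h]`_i.

Definition expi (R : realType) (a : R) : R[i] := cos a +i* sin a.

Definition helicoidal (R : realType) (omega C : R) (x y : R -> R) (s t : R) :
    'rV[R]_3 :=
  vec3 ((x s +i* y s) * expi (- (omega * t))) (t + C).

Definition eta1 (R : realType) (x y : R -> R) (s : R) : R :=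
  - (2^-1 * derive1 (fun u => x u ^+ 2 + y u ^+ 2) s).

Definition eta2 (R : realType) (x y : R -> R) (s : R) : R :=
  x s * derive1 y s - y s * derive1 x s.

(* The factor x_s + i y_s is exp(i phi), phi being the angle of the tangent. *)
Definition helicoidal_normal (R : realType) (omega : R) (x y : R -> R)
    (s t : R) : 'rV[R]_3 :=
  (Num.sqrt (1 + omega ^+ 2 * eta1 x y s ^+ 2))^-1 *:
  vec3 (- (0 +i* 1) * ((derive1 x s +i* derive1 y s) * expi (- (omega * t))))
       (omega * eta1 x y s).

(* Main.v *)
Require Import Defs.
From HB Require Import structures.
From mathcomp Require Import all_boot all_order all_algebra.
From mathcomp Require Import all_classical all_reals all_analysis.
From mathcomp Require Import complex ring lra.
Import Order.TTheory GRing.Theory Num.Theory.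
Import numFieldNormedType.Exports.
Local Open Scope ring_scope.
Local Open Scope classical_set_scope.

(** Both the surface and the energy are invariant under the screw motions, so
the anisotropic mean curvature is a function [H] of the arc length [s] alone.
The point is that the derivative of the first integral is a multiple of
[Lambda - H].

Write [W] for the area factor sqrt (1 + omega^2 eta1^2), [nu3] for the third
coordinate omega eta1 / W of the normal, [r] for the radius 1 / mu2 (nu3) and
[k] for the curvature of the plane curve.  For an axially symmetric density the
Cahn-Hoffman field is r nu + g'(nu3) e3 ([grad_homog_ext]).  In the frame turned
by the angle - omega theta, the coordinate tangent vectors have Gram matrix
((1, - omega eta2), (- omega eta2, omega^2 eta2^2 + W^2)), of determinant W^2,
and the trace that defines the surface divergence comes out as
- H = k r / W + omega^2 eta2 eta1' (g''(nu3) + r W^2) / W^5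
([aniso_mean_curvature_helicoidal]).

The Frenet equations give eta1' = k eta2 - 1 and eta2' = - k eta1, and
(r / W)' = - omega^2 eta1 eta1' (g''(nu3) + r W^2) / W^5.  Hence the function
Phi = Lambda (eta1^2 + eta2^2) + 2 eta2 r / W has derivative
- 2 eta1 (Lambda - H) ([is_derive_first_integral_density]).  If H = Lambda then
Phi is constant on the interval, which is the first integral.

Conversely, if Phi is constant then eta1 (Lambda - H) = 0, which says nothing
about H where eta1 vanishes.  Suppose H s0 <> Lambda.  The set where H = H s0 is
closed in the interval, because H is continuous.  It is also open: near one of
its points H <> Lambda, so eta1 = 0, so the curve is an arc of a circle centred
at the origin, along which H is constant
([mean_curvature_profile_locally_cst]).  By connectedness H = H s0 <> Lambda
everywhere, so eta1 vanishes identically, which is excluded.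

The third coordinate of the normal stays in the open interval ]-1, 1[, so the
formulas only involve the profile g away from the poles.  There g inherits two
continuous derivatives from the smoothness of the density, being its restriction
to a meridian ([profile_C2]). *)

Set Implicit Arguments.
Unset Strict Implicit.

(** * One-variable calculus *)

(** The rules of differentiation in pointwise form: the derivative of a formula
in [s] is then written down as a term that mirrors the formula. *)
Lemma is_derive1D (R : realType) (f g : R -> R) (s a b : R) :
  is_derive s 1 f a -> is_derive s 1 g b ->
  is_derive s 1 (fun u => f u + g u) (a + b).
Proof. by move=> fa gb; exact: is_deriveD. Qed.

Lemma is_derive1N (R : realType) (f : R -> R) (s a : R) :
  is_derive s 1 f a -> is_derive s 1 (fun u => - f u) (- a).
Proof. by move=> fa; exact: is_deriveN. Qed.

Lemma is_derive1M (R : realType) (f g : R -> R) (s a b : R) :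
  is_derive s 1 f a -> is_derive s 1 g b ->
  is_derive s 1 (fun u => f u * g u) (a * g s + f s * b).
Proof.
move=> fa gb; apply: (is_derive_eq (is_deriveM fa gb)).
by rewrite /GRing.scale/=; ring.
Qed.

Lemma is_derive1_sqr (R : realType) (f : R -> R) (s a : R) :
  is_derive s 1 f a -> is_derive s 1 (fun u => f u ^+ 2) (2 * f s * a).
Proof. by move=> fa; apply: (is_derive_eq (is_derive1M fa fa)); ring. Qed.

Lemma is_derive1_cst (R : realType) (c s : R) :
  is_derive s 1 (fun _ : R => c) 0.
Proof. exact: is_derive_cst. Qed.

Lemma is_derive1_id (R : realType) (s : R) : is_derive s 1 (fun u : R => u) 1.
Proof. exact: is_derive_id. Qed.

Lemma is_derive1_inv (R : realType) (f : R -> R) (s a : R) :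
  f s != 0 -> is_derive s 1 f a ->
  is_derive s 1 (fun u => (f u)^-1) (- a / f s ^+ 2).
Proof.
move=> f0 fa; apply: (is_derive_eq (is_deriveV f0 fa)).
by rewrite /GRing.scale/=; ring.
Qed.

Lemma is_derive1_chain (R : realType) (f g : R -> R) (s a b : R) :
  is_derive (f s) 1 g b -> is_derive s 1 f a ->
  is_derive s 1 (fun u => g (f u)) (b * a).
Proof. by move=> gb fa; exact: is_derive1_comp. Qed.

Lemma is_derive1_sqrt_comp (R : realType) (f : R -> R) (s a : R) :
  0 < f s -> is_derive s 1 f a ->
  is_derive s 1 (fun u => Num.sqrt (f u)) (a / (2 * Num.sqrt (f s))).
Proof.
move=> f0 fa.
apply: (is_derive_eq (is_derive1_chain (is_derive1_sqrt f0) fa)).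
by ring.
Qed.

Lemma is_derive1_val (R : realType) (f : R -> R) (s a : R) :
  is_derive s 1 f a -> derive1 f s = a.
Proof. by move=> fa; rewrite derive1E derive_val. Qed.

Lemma is_derive1_continuous (R : realType) (f : R -> R) (s a : R) :
  is_derive s 1 f a -> {for s, continuous f}.
Proof.
by move=> fa; exact/differentiable_continuous/derivable1_diffP.
Qed.

Lemma continuous1D (R : realType) (f g : R -> R) (s : R) :
  {for s, continuous f} -> {for s, continuous g} ->
  {for s, continuous (fun u => f u + g u)}.
Proof. by move=> cf cg; exact: continuousD. Qed.

Lemma continuous1M (R : realType) (f g : R -> R) (s : R) :
  {for s, continuous f} -> {for s, continuous g} ->
  {for s, continuous (fun u => f u * g u)}.
Proof. by move=> cf cg; exact: continuousM. Qed.

Lemma continuous_near_eq (R : realType) (f h : R -> R) (t : R) :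
  (\near t, f t = h t) -> {for t, continuous h} -> {for t, continuous f}.
Proof.
move=> fh ch; rewrite /prop_for /continuous_at (nbhs_singleton fh).
by apply: cvg_trans ch; apply: near_eq_cvg; near do apply/esym.
Unshelve. all: by end_near. Qed.

Lemma continuous_near_neq (R : realType) (f : R -> R) (s c : R) :
  {for s, continuous f} -> f s != c -> \forall u \near s, f u != c.
Proof.
move=> cf fc.
have cc : {for s, continuous (fun _ : R => - c)} by exact: cst_continuous.
have cd := continuous1D cf cc.
have fc0 : f s - c != 0 by rewrite subr_eq0.
near=> v; rewrite -subr_eq0; near: v; exact: (cvgr_neq0 _ cd fc0).
Unshelve. all: by end_near. Qed.

Lemma cst_on_interval (R : realType) (J : set R) (f : R -> R) :
  is_interval J -> (forall u, J u -> is_derive u 1 f 0) ->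
  forall u v, J u -> J v -> f u = f v.
Proof.
move=> Jint df u v; wlog uv : u v / u <= v => [h Ju Jv|Ju Jv].
  by have [uv|/ltW vu] := leP u v; [exact: h | exact/esym/h].
have Juv w : w \in `[u, v]%R -> J w by rewrite in_itv/=; exact: Jint.
have df' w : w \in `]u, v[%R -> is_derive w 1 f 0.
  by move=> /subset_itv_oo_cc/Juv/df.
have cf : {within `[u, v], continuous f}.
  apply: continuous_in_subspaceT => w; rewrite inE => /Juv/df.
  exact: is_derive1_continuous.
have [w _] := @MVT_segment _ f (fun=> 0) u v uv df' cf.
by rewrite mul0r => /eqP; rewrite subr_eq0 => /eqP.
Qed.

(** A continuous function that is locally constant at every point where it
takes its value at [s0] is constant: the set of these points is open and closed
in the interval. *)
Lemma locally_cst_on_interval (R : realType) (I : set R) (f : R -> R) (s0 : R) :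
  is_interval I -> I s0 -> (forall s, I s -> {for s, continuous f}) ->
  (forall s, I s -> f s = f s0 -> \forall u \near s, f u = f s0) ->
  forall s, I s -> f s = f s0.
Proof.
move=> /connected_intervalP Iconn Is0 cf lf s Is.
pose L := [set u | f u = f s0].
have BE : I `&` L = I.
  apply: Iconn; first by exists s0.
    exists L^°; first exact: open_interior.
    apply/seteqP; split=> u [Iu Lu]; split=> //; first exact: lf.
    exact: interior_subset.
  exists (closure L); first exact: closed_closure.
  apply/seteqP; split=> u [Iu Lu]; split=> //; first exact: subset_closure.
  apply/eqP; apply: contrapT => /negP fu.
  have : \forall v \near u, f v != f s0.
    exact: (continuous_near_neq (cf u Iu) fu).
  by move=> /Lu [v [/= -> /eqP]].
by have [] : (I `&` L) s by rewrite BE.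
Qed.

Lemma near_open (R : realType) (I : set R) (P : R -> Prop) (s : R) :
  open I -> I s -> (forall u, I u -> P u) -> \forall u \near s, P u.
Proof.
by move=> I_open Is h; apply: filterS h _; exact: open_nbhs_nbhs.
Qed.

(** * Vectors of three-space *)

Lemma vec3E (R : realType) (a b h : R) :
  (vec3 (a +i* b)%C h 0 0 = a) * (vec3 (a +i* b)%C h 0 1 = b) *
  (vec3 (a +i* b)%C h 0 ord_max = h).
Proof. by rewrite !mxE. Qed.

Lemma vec3_eq (R : realType) (a b h a' b' h' : R) :
  a = a' -> b = b' -> h = h' -> vec3 (a +i* b)%C h = vec3 (a' +i* b')%C h'.
Proof. by move=> -> -> ->. Qed.

Lemma dotE (R : realType) (u v : 'rV[R]_3) :
  dot u v = u 0 0 * v 0 0 + u 0 1 * v 0 1 + u 0 ord_max * v 0 ord_max.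
Proof.
rewrite /dot !big_ord_recl big_ord0 addr0 addrA.
by congr (_ + _ * _ + _ * _); congr (_ _ _); apply/val_inj.
Qed.

Lemma dot_vec3 (R : realType) (a b h a' b' h' : R) :
  dot (vec3 (a +i* b)%C h) (vec3 (a' +i* b')%C h') = a * a' + b * b' + h * h'.
Proof. by rewrite dotE !vec3E. Qed.

Lemma row3P (R : realType) (u v : 'rV[R]_3) :
  u 0 0 = v 0 0 -> u 0 1 = v 0 1 -> u 0 ord_max = v 0 ord_max -> u = v.
Proof.
move=> h0 h1 h2; apply/rowP => -[[|[|[|//]]] i3].
- by rewrite (_ : Ordinal i3 = 0)//; apply/val_inj.
- by rewrite (_ : Ordinal i3 = 1)//; apply/val_inj.
- by rewrite (_ : Ordinal i3 = ord_max)//; apply/val_inj.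
Qed.

Lemma is_derive_row3 (R : realType) (V : normedModType R) (M : V -> 'rV[R]_3)
    (p v : V) (d : 'rV[R]_3) :
  (forall i, is_derive p v (fun q => M q 0 i) (d 0 i)) -> is_derive p v M d.
Proof.
move=> Md; have Mv : derivable M p v.
  by apply/derivable_mxP => i j; rewrite (ord1 i); apply: ex_derive.
apply: DeriveDef => //; rewrite derive_mx//.
by apply/rowP => j; rewrite mxE; apply: derive_val.
Qed.

Lemma is_derive_vec3 (R : realType) (a b h : R -> R) (s a' b' h' : R) :
  is_derive s 1 a a' -> is_derive s 1 b b' -> is_derive s 1 h h' ->
  is_derive s 1 (fun u => vec3 (a u +i* b u)%C (h u)) (vec3 (a' +i* b')%C h').
Proof.
move=> da db dh; apply: is_derive_row3 => -[[|[|[|//]]] i3];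
  rewrite mxE/=;
  (rewrite (_ : (fun _ => _) = a); last by apply/funext => u; rewrite mxE) ||
  (rewrite (_ : (fun _ => _) = b); last by apply/funext => u; rewrite mxE) ||
  (rewrite (_ : (fun _ => _) = h); last by apply/funext => u; rewrite mxE);
  assumption.
Qed.

(** The trace of the differential of a field over the tangent plane with basis
[a], [b] is a quotient with the determinant of the Gram matrix as denominator,
because the inverse of a 2 x 2 Gram matrix is explicit. *)
Lemma trace_mul_invgram (R : realType) (a b c d : 'rV[R]_3) :
  dot a a * dot b b - dot a b ^+ 2 != 0 ->
  \tr ((col_mx c d *m (col_mx a b)^T)
       *m invmx (col_mx a b *m (col_mx a b)^T)) =
  (dot c a * dot b b - dot c b * dot a b - dot d a * dot a b
   + dot d b * dot a a) / (dot a a * dot b b - dot a b ^+ 2).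
Proof.
move=> D0.
have mulE (u v : 'rV[R]_3) : u *m v^T = (dot u v)%:M.
  apply/matrixP => i j; rewrite !ord1 !mxE eqxx mulr1n.
  by apply: eq_bigr => k _; rewrite mxE.
have dotC (u v : 'rV[R]_3) : dot u v = dot v u.
  by apply: eq_bigr => k _; rewrite mulrC.
rewrite !tr_col_mx !mul_col_row !mulE (dotC b a).
set D := (X in X != 0) in D0 *.
set E := dot a a in D0 *; set F := dot a b in D0 *; set G := dot b b in D0 *.
have DE : E * G - F ^+ 2 = D by [].
pose B : 'M[R]_(1 + 1) :=
  block_mx (G / D)%:M (- F / D)%:M (- F / D)%:M (E / D)%:M.
set A := (X in invmx X).
have AB : A *m B = 1%:M.
  rewrite /A /B mulmx_block -!scalar_mxM -!raddfD/=.
  rewrite [1%:M in RHS](@scalar_mx_block _ 1 1).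
  congr block_mx; rewrite -?(raddf0 (@scalar_mx R 1)); congr (_%:M); [|ring..|].
    by rewrite -[1](divff D0) -[X in _ = X / _]DE; ring.
  by rewrite -[1](divff D0) -[X in _ = X / _]DE; ring.
have -> : invmx A = B.
  have [Au _] := mulmx1_unit AB.
  by rewrite -[LHS]mulmx1 -AB mulKmx.
rewrite /B mulmx_block -!scalar_mxM -!raddfD/= mxtrace_block !mxtrace_scalar.
by rewrite !mulr1n; ring.
Qed.

(** * The profile of an axially symmetric density *)

Definition meridian (R : realType) (t : R) : 'rV[R]_3 :=
  vec3 (Num.sqrt (1 - t ^+ 2) +i* 0)%C t.

Definition meridian_slope (R : realType) (t : R) : R :=
  - t * (Num.sqrt (1 - t ^+ 2))^-1.

Lemma onem_sqr_gt0 (R : realType) (t : R) : -1 < t < 1 -> 0 < 1 - t ^+ 2.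
Proof. by move=> /andP[t1 t2]; nra. Qed.

Lemma meridian_sphere (R : realType) (t : R) :
  -1 < t < 1 -> sphere2 (meridian t).
Proof.
move=> t1; rewrite /sphere2/= /enorm dot_vec3 -expr2.
by rewrite sqr_sqrtr ?ltW ?onem_sqr_gt0// mulr0 addr0 -expr2 subrK sqrtr1.
Qed.

Lemma is_derive_sqrt_onem_sqr (R : realType) (t : R) : -1 < t < 1 ->
  is_derive t 1 (fun u => Num.sqrt (1 - u ^+ 2)) (meridian_slope t).
Proof.
move=> t1; have t0 := onem_sqr_gt0 t1.
have did := is_derive_id t (1 : R).
apply: (is_derive_eq (@is_derive1_sqrt_comp _ (fun u => 1 - u ^+ 2) _ _ t0
  (is_derive1D (is_derive1_cst 1 t) (is_derive1N (is_derive1_sqr did))))).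
rewrite /meridian_slope.
have := t0; rewrite -sqrtr_gt0 => r0.
by field; rewrite gt_eqF.
Qed.

Lemma is_derive_meridian_slope (R : realType) (t : R) : -1 < t < 1 ->
  is_derive t 1 (@meridian_slope R) (- (Num.sqrt (1 - t ^+ 2))^-1 ^+ 3).
Proof.
move=> t1; have t0 := onem_sqr_gt0 t1.
have := t0; rewrite -sqrtr_gt0 => r0.
have did := is_derive_id t (1 : R).
have di := @is_derive1_inv _ (fun u => Num.sqrt (1 - u ^+ 2)) _ _
  (lt0r_neq0 r0) (is_derive_sqrt_onem_sqr t1).
apply: (is_derive_eq (is_derive1M (is_derive1N did) di)).
rewrite /meridian_slope.
have : Num.sqrt (1 - t ^+ 2) ^+ 2 = 1 - t ^+ 2 by rewrite sqr_sqrtr// ltW.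
move: (Num.sqrt _) r0 => r r0 r2.
have r30 : r ^+ 3 != 0 by rewrite expf_neq0// gt_eqF.
apply: (mulIf r30); transitivity (- (r ^+ 2 + t ^+ 2)).
  by field; rewrite gt_eqF.
by rewrite r2; field; rewrite gt_eqF.
Qed.

Lemma is_derive_meridian (R : realType) (t : R) : -1 < t < 1 ->
  is_derive t 1 (@meridian R) (vec3 (meridian_slope t +i* 0)%C 1).
Proof.
move=> t1; apply: is_derive_vec3.
exact: is_derive_sqrt_onem_sqr.
Qed.

Lemma is_derive_comp_meridian (R : realType) (F : 'rV[R]_3 -> R) (t : R) :
  -1 < t < 1 -> differentiable F (meridian t) ->
  is_derive t 1 (fun u => F (meridian u))
    (meridian_slope t * 'D_(delta_mx 0 0) F (meridian t)
     + 'D_(delta_mx 0 ord_max) F (meridian t)).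
Proof.
move=> t1 dF; have dm := is_derive_meridian t1.
have dm' : differentiable (@meridian R) t by apply/derivable1_diffP.
have dFm : differentiable (F \o @meridian R) t by exact: differentiable_comp.
apply: DeriveDef; first exact/derivable1_diffP.
have -> : 'D_1 (fun u => F (meridian u)) t = 'D_1 (F \o @meridian R) t by [].
rewrite !deriveE// diff_comp//= -(deriveE _ dm') (@derive_val _ _ _ _ _ _ _ dm).
have -> : vec3 (meridian_slope t +i* 0)%C 1
    = meridian_slope t *: delta_mx 0 0 + delta_mx 0 ord_max :> 'rV[R]_3.
  by apply: row3P; rewrite vec3E !mxE/=; ring.
by rewrite linearD linearZ.
Qed.

Lemma continuous_comp_meridian (R : realType) (F : 'rV[R]_3 -> R) (t : R) :
  -1 < t < 1 -> {for meridian t, continuous F} ->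
  {for t, continuous (fun u => F (meridian u))}.
Proof.
move=> t1 cF; apply: (@continuous_comp _ _ _ (@meridian R) F) => //.
have dm := is_derive_meridian t1.
exact/differentiable_continuous/derivable1_diffP.
Qed.

Lemma near_itv11 (R : realType) (t : R) (P : R -> Prop) : -1 < t < 1 ->
  (forall u, -1 < u < 1 -> P u) -> \forall u \near t, P u.
Proof.
move=> t1 h; have : t \in `](-1), 1[%R by rewrite in_itv.
by move=> /near_in_itvoo; apply: filterS => u; rewrite in_itv; exact: h.
Qed.

(** On ]-1, 1[ the profile is the restriction to a meridian of a function that
is smooth near the sphere. *)
Lemma profile_C2 (R : realType) (gamma : 'rV[R]_3 -> R) (g : R -> R) (t : R) :
  smooth_on_sphere gamma -> axially_symmetric gamma g -> -1 < t < 1 ->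
  [/\ is_derive t 1 g (derive1 g t),
      is_derive t 1 (derive1 g) (derive1 (derive1 g) t) &
      {for t, continuous (derive1 (derive1 g))}].
Proof.
move=> gamma_smooth gamma_axial t1.
have [U [F [_ SU Fsmooth Fgamma]]] := gamma_smooth.
have mU (u : R) : -1 < u < 1 -> U (meridian u) by move=> /meridian_sphere/SU.
have /= [dF dDF] := Fsmooth 2%N.
pose D i := 'D_(delta_mx 0 i) F.
pose DD i j := 'D_(delta_mx 0 j) (D i).
have dD i p : U p -> differentiable (D i) p by exact: (dDF _).1.
have cDD i j p : U p -> {for p, continuous (DD i j)} by exact: (dDF _).2.
pose c := @meridian R; pose m := @meridian_slope R.
pose g1 (u : R) : R := m u * D 0 (c u) + D ord_max (c u).
pose g2 (u : R) : R := - (Num.sqrt (1 - u ^+ 2))^-1 ^+ 3 * D 0 (c u)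
  + m u * (m u * DD 0 0 (c u) + DD 0 ord_max (c u))
  + (m u * DD ord_max 0 (c u) + DD ord_max ord_max (c u)).
have gE (u : R) : -1 < u < 1 -> F (c u) = g u.
  move=> u1; have := meridian_sphere u1 => cu.
  by rewrite Fgamma// gamma_axial// /c /meridian vec3E.
have dg (u : R) : -1 < u < 1 -> is_derive u 1 g (g1 u).
  move=> u1; apply: (@near_eq_is_derive _ _ _ (fun u => F (c u))).
    exact: near_itv11.
  by apply: is_derive_comp_meridian => //; apply/dF/mU.
have dg1 (u : R) : -1 < u < 1 -> is_derive u 1 g1 (g2 u).
  move=> u1; apply: is_derive1D.
    apply: is_derive1M; first exact: is_derive_meridian_slope.
    by apply: is_derive_comp_meridian => //; apply/dD/mU.
  by apply: is_derive_comp_meridian => //; apply/dD/mU.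
have dgE (u : R) : -1 < u < 1 -> derive1 g u = g1 u.
  by move=> /dg/is_derive1_val.
have ddg (u : R) : -1 < u < 1 -> is_derive u 1 (derive1 g) (g2 u).
  move=> u1; apply: (@near_eq_is_derive _ _ _ g1); last exact: dg1.
  by apply: near_itv11 => // v /dgE.
have ddgE (u : R) : -1 < u < 1 -> derive1 (derive1 g) u = g2 u.
  by move=> /ddg/is_derive1_val.
split; first by rewrite dgE//; exact: dg.
  by rewrite ddgE//; exact: ddg.
apply: (@continuous_near_eq _ _ g2); first exact: near_itv11.
have r0 : Num.sqrt (1 - t ^+ 2) != 0.
  by rewrite lt0r_neq0// sqrtr_gt0 onem_sqr_gt0.
have cm := is_derive1_continuous (is_derive_meridian_slope t1).
have di := @is_derive1_inv _ (fun u => Num.sqrt (1 - u ^+ 2)) _ _ r0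
  (is_derive_sqrt_onem_sqr t1).
have ci : {for t, continuous (fun u : R => - (Num.sqrt (1 - u ^+ 2))^-1 ^+ 3)}.
  exact: (is_derive1_continuous
    (is_derive1N (is_derive1M di (is_derive1M di di)))).
have cD i : {for t, continuous (fun u => D i (c u))}.
  apply: continuous_comp_meridian => //.
  exact/differentiable_continuous/dD/mU.
have cDDc i j : {for t, continuous (fun u => DD i j (c u))}.
  by apply: continuous_comp_meridian => //; apply/cDD/mU.
apply: (continuous1D (continuous1D (continuous1M ci (cD _))
  (continuous1M cm (continuous1D (continuous1M cm (cDDc _ _)) (cDDc _ _))))
  (continuous1D (continuous1M cm (cDDc _ _)) (cDDc _ _))).
Qed.

(** * The gradient of the homogeneous extension *)

(** A directional derivative is a derivative of the restriction to a line, so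
one-variable calculus suffices for the gradient. *)
Lemma is_derive_line (R : realType) (V W : normedModType R) (f : V -> W)
    (p v : V) (d : W) :
  is_derive (0 : R) 1 (fun h => f (h *: v + p)) d -> is_derive p v f d.
Proof.
move=> fd; have [df _] := fd; apply: DeriveDef; first exact/derivable1P.
rewrite -(@derive_val _ _ _ _ _ _ _ fd) /derive.
apply: (congr1 (fun F : R -> W => lim (F @ 0^'))).
by apply/funext => h /=; rewrite addr0 scale0r add0r [_%:A]mulr1.
Qed.

Lemma sphere_normalize (R : realType) (Y : 'rV[R]_3) :
  0 < dot Y Y -> sphere2 ((enorm Y)^-1 *: Y).
Proof.
move=> Y0; rewrite /sphere2 /enorm/=.
have r0 : 0 < Num.sqrt (dot Y Y) by rewrite sqrtr_gt0.
have r2 : dot Y Y = Num.sqrt (dot Y Y) ^+ 2 by rewrite sqr_sqrtr ?ltW.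
move: (Num.sqrt (dot Y Y)) r0 r2 => r r0 r2.
rewrite (_ : dot _ _ = r^-1 ^+ 2 * dot Y Y); last by rewrite !dotE !mxE; ring.
by rewrite r2 -exprMn mulVf ?gt_eqF// expr1n sqrtr1.
Qed.

(** Along the line [n + h v] the extension of an axially symmetric density is
[|n + h v| * g (t(h))], where [t(h)] is the third coordinate of the normalized
point; at [h = 0] the two factors have derivatives [<v, n>] and
[g' * (v_3 - t * <v, n>)]. *)
Lemma grad_homog_ext (R : realType) (gamma : 'rV[R]_3 -> R) (g : R -> R)
    (n : 'rV[R]_3) (t := n 0 ord_max) (g' : R) :
  axially_symmetric gamma g -> is_derive t 1 g g' -> dot n n = 1 ->
  grad (homog_ext gamma) n = (g t - t * g') *: n + g' *: delta_mx 0 ord_max.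
Proof.
move=> gamma_axial dg n1; apply/rowP => i; rewrite !mxE/=.
set v : 'rV[R]_3 := delta_mx 0 i.
have vn : dot v n = n 0 i.
  rewrite /dot (bigD1 i)//= mxE !eqxx mul1r big1 ?addr0// => j ji.
  by rewrite mxE (negbTE ji) andbF mul0r.
pose q (h : R) : R := 1 + 2 * h * n 0 i + h ^+ 2 * dot v v.
have qE h : dot (h *: v + n) (h *: v + n) = q h.
  transitivity (dot n n + 2 * h * dot v n + h ^+ 2 * dot v v).
    by rewrite !dotE !mxE; ring.
  by rewrite n1 vn.
have q0 : q 0 = 1 by rewrite /q; ring.
have did := is_derive1_id (0 : R).
have dcst (c : R) := is_derive1_cst c 0.
have dq : is_derive (0 : R) 1 q (2 * n 0 i).
  apply: is_derive_eq (is_derive1D (is_derive1D (dcst 1)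
    (is_derive1M (is_derive1M (dcst 2) did) (dcst (n 0 i))))
    (is_derive1M (is_derive1_sqr did) (dcst (dot v v)))) _.
  by ring.
have dr : is_derive (0 : R) 1 (fun h => Num.sqrt (q h)) (n 0 i).
  have q0' : 0 < q 0 by rewrite q0.
  apply: is_derive_eq (is_derive1_sqrt_comp q0' dq) _.
  by rewrite q0 sqrtr1; field.
pose t' (h : R) : R := (h * v 0 ord_max + t) * (Num.sqrt (q h))^-1.
have t'0 : t' 0 = t by rewrite /t' q0 sqrtr1; field.
have dt : is_derive (0 : R) 1 t' (v 0 ord_max - t * n 0 i).
  have r0 : Num.sqrt (q 0) != 0 by rewrite q0 sqrtr1 oner_neq0.
  apply: is_derive_eq (is_derive1M
    (is_derive1D (is_derive1M did (dcst (v 0 ord_max))) (dcst t))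
    (@is_derive1_inv _ (fun h => Num.sqrt (q h)) _ _ r0 dr)) _.
  by rewrite q0 sqrtr1; field.
have vE : v 0 ord_max = (ord_max == i)%:R by rewrite mxE eqxx.
rewrite eq_sym -vE.
apply: derive_val; apply: is_derive_line.
apply: (@near_eq_is_derive _ _ _ (fun h => Num.sqrt (q h) * g (t' h))).
  have := is_derive1_continuous dq.
  rewrite /prop_for /continuous_at q0 => /cvgr_gt/(_ 0 ltr01).
  apply: filterS => h /= qh; rewrite /homog_ext gamma_axial; last first.
    by apply: sphere_normalize; rewrite qE.
  by rewrite /enorm qE /t' !mxE [_^-1 * _]mulrC.
have dg0 : is_derive (t' 0) 1 g g' by rewrite t'0.
apply: is_derive_eq (is_derive1M dr (is_derive1_chain dg0 dt)) _.
by rewrite t'0 q0 sqrtr1; ring.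
Qed.

(** * The profile curve *)

Lemma smooth_on_C2 (R : realType) (I : set R) (f : R -> R) (s : R) :
  smooth_on I f -> I s ->
  [/\ is_derive s 1 f (derive1 f s),
      is_derive s 1 (derive1 f) (derive1 (derive1 f) s) &
      {for s, continuous (derive1 (derive1 f))}].
Proof.
move=> /(_ 2%N) /= [df /(_ 1) [ddf /(_ 1) cddf]] Is.
have dE h : derive1 h = 'D_1 h :> (R -> R).
  by apply/funext => u; rewrite derive1E.
rewrite !dE; split; last exact: cddf.
  by apply/derivableP/derivable1_diffP/df.
by apply/derivableP/derivable1_diffP/ddf.
Qed.

Definition curve_curvature (R : realType) (x y : R -> R) (s : R) : R :=
  derive1 x s * derive1 (derive1 y) s - derive1 y s * derive1 (derive1 x) s.

(** The area element of the surface in the coordinates (s, theta), that is, the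
norm of the cross product of the two coordinate tangent vectors. *)
Definition area_factor (R : realType) (omega : R) (x y : R -> R) (s : R) : R :=
  Num.sqrt (1 + omega ^+ 2 * eta1 x y s ^+ 2).

(** The third coordinate of the unit normal of the surface. *)
Definition nu3 (R : realType) (omega : R) (x y : R -> R) (s : R) : R :=
  omega * eta1 x y s / area_factor omega x y s.

Lemma area_factor_gt0 (R : realType) (omega : R) (x y : R -> R) (s : R) :
  0 < area_factor omega x y s.
Proof. by rewrite sqrtr_gt0; nra. Qed.

Lemma area_factor_sqr (R : realType) (omega : R) (x y : R -> R) (s : R) :
  area_factor omega x y s ^+ 2 = 1 + omega ^+ 2 * eta1 x y s ^+ 2.
Proof. by rewrite sqr_sqrtr//; nra. Qed.

(** The normal of a helicoidal surface is never vertical. *)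
Lemma nu3_itv (R : realType) (omega : R) (x y : R -> R) (s : R) :
  -1 < nu3 omega x y s < 1.
Proof.
rewrite /nu3; have := area_factor_sqr omega x y s.
have := area_factor_gt0 omega x y s.
move: (area_factor _ _ _ _) (eta1 _ _ _) => W e W0 W2.
by rewrite ltr_pdivlMr// ltr_pdivrMr//; nra.
Qed.

(** The principal radius of curvature of the Wulff shape in the direction of the
parallels. *)
Definition radius2 (R : realType) (g : R -> R) (u : R) : R := (mu2 g u)^-1.

Lemma radius2E (R : realType) (g : R -> R) (u : R) :
  radius2 g u = g u - u * derive1 g u.
Proof. exact: invrK. Qed.

(** * Surface divergence *)

(** The surface divergence of a field that is carried along by a screw motion,
with [(z1, z2)] the horizontal position, [(m, l)] the unit tangent of the
horizontal curve, and [- w] the angular velocity of the motion.  The horizontal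
part of the field is [p] times the normal [(l, - m)], and this normal turns at
the rate [k] along the curve; [p'] and [q'] are the derivatives of [p] and of
the height of the field.  The terms of second order in [e2] cancel. *)
Lemma surface_div_frame (R : realType) (X xi : R -> R -> 'rV[R]_3)
    (s th m l z1 z2 w k p p' q' : R)
    (e1 := - (z1 * m + z2 * l)) (e2 := z1 * l - z2 * m) :
  m ^+ 2 + l ^+ 2 = 1 ->
  is_derive s 1 (fun u => X u th) (vec3 (m +i* l)%C 0) ->
  is_derive th 1 (X s) (vec3 ((w * z2) +i* (- (w * z1)))%C 1) ->
  is_derive s 1 (fun u => xi u th)
    (vec3 ((p' * l + p * k * m) +i* (- (p' * m) + p * k * l))%C q') ->
  is_derive th 1 (xi s) (vec3 ((- (w * p * m)) +i* (- (w * p * l)))%C 0) ->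
  surface_div X xi s th
  = k * p + w * e2 * (q' - w * e1 * p') / (1 + w ^+ 2 * e1 ^+ 2).
Proof.
move=> ml dX_s dX_th dxi_s dxi_th.
rewrite /surface_div /jac !derive1E !derive_val.
set X_s := vec3 (m +i* l)%C 0; set X_th := vec3 _ 1.
set xi_s := vec3 _ q'; set xi_th := vec3 _ 0.
have E : dot X_s X_s = 1 by rewrite dot_vec3 -ml; ring.
have F : dot X_s X_th = - (w * e2) by rewrite dot_vec3 /e2; ring.
have G : dot X_th X_th = w ^+ 2 * e2 ^+ 2 + (1 + w ^+ 2 * e1 ^+ 2).
  transitivity (1 + w ^+ 2 * ((z1 ^+ 2 + z2 ^+ 2) * (m ^+ 2 + l ^+ 2))).
    by rewrite dot_vec3 ml; ring.
  by rewrite /e1 /e2; ring.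
have D : dot X_s X_s * dot X_th X_th - dot X_s X_th ^+ 2
    = 1 + w ^+ 2 * e1 ^+ 2 by rewrite E F G; ring.
have D0 : 1 + w ^+ 2 * e1 ^+ 2 != 0.
  by rewrite gt_eqF// -exprMn ltr_pwDl// sqr_ge0.
have xi_sX_s : dot xi_s X_s = p * k.
  by rewrite dot_vec3 -[RHS]mulr1 -ml; ring.
have xi_sX_th : dot xi_s X_th = - (w * e1 * p') - w * e2 * p * k + q'.
  by rewrite dot_vec3 /e1 /e2; ring.
have xi_thX_s : dot xi_th X_s = - (w * p).
  by rewrite dot_vec3 -[RHS]mulr1 -ml; ring.
have xi_thX_th : dot xi_th X_th = w ^+ 2 * p * e2.
  by rewrite dot_vec3 /e2; ring.
rewrite trace_mul_invgram D// E F G xi_sX_s xi_sX_th xi_thX_s xi_thX_th.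
by move: (1 + _) D0 {D G} => d d0; field.
Qed.

Section helicoidal_surface.
Variables (R : realType) (gamma : 'rV[R]_3 -> R) (g : R -> R).
Hypotheses (gamma_smooth : smooth_on_sphere gamma)
           (gamma_axial : axially_symmetric gamma g).
Variables (omega C : R) (I : set R) (x y : R -> R).
Hypotheses (I_open : open I) (x_smooth : smooth_on I x)
           (y_smooth : smooth_on I y).
Hypothesis arc_length :
  forall s, I s -> derive1 x s ^+ 2 + derive1 y s ^+ 2 = 1.

Let W := area_factor omega x y.
Let t := nu3 omega x y.
Let k := curve_curvature x y.
Let rho := radius2 g.
Let eta1' (s : R) : R := k s * eta2 x y s - 1.
Let b (s : R) : R := derive1 (derive1 g) (t s) + rho (t s) * W s ^+ 2.
Let n := helicoidal_normal omega x y.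
Let co (th : R) : R := cos (- (omega * th)).
Let si (th : R) : R := sin (- (omega * th)).

Lemma eta1E s : I s -> eta1 x y s = - (x s * derive1 x s + y s * derive1 y s).
Proof.
move=> Is; have [dx _ _] := smooth_on_C2 x_smooth Is.
have [dy _ _] := smooth_on_C2 y_smooth Is.
have := is_derive1D (is_derive1_sqr dx) (is_derive1_sqr dy).
by rewrite /eta1 => /is_derive1_val ->; field.
Qed.

(** Differentiating the arc length condition shows that the acceleration is
orthogonal to the velocity. *)
Lemma frenet s : I s ->
  derive1 (derive1 x) s = - k s * derive1 y s /\
  derive1 (derive1 y) s = k s * derive1 x s.
Proof.
move=> Is; have [_ dx _] := smooth_on_C2 x_smooth Is.
have [_ dy _] := smooth_on_C2 y_smooth Is.
have al := arc_length Is.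
have /is_derive1_val h := is_derive1D (is_derive1_sqr dx) (is_derive1_sqr dy).
have : derive1 (fun u => derive1 x u ^+ 2 + derive1 y u ^+ 2) s = 0.
  rewrite derive1E (@near_eq_derive _ _ _ _ (cst (1 : R))) ?derive_cst//.
  by apply: (near_open I_open Is) => u /arc_length.
rewrite h /k /curve_curvature; move: al.
move: (derive1 x s) (derive1 y s) => x1 y1.
move: (derive1 (derive1 x) s) (derive1 (derive1 y) s) => x2 y2 al h0.
have {}h0 : x1 * x2 + y1 * y2 = 0.
  apply: (@mulfI _ (2 : R)); first by rewrite pnatr_eq0.
  by rewrite mulr0 -h0; ring.
split; rewrite -[LHS]mul1r -al.
  transitivity (x1 * (x1 * x2 + y1 * y2) - (x1 * y2 - y1 * x2) * y1).
    by ring.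
  by rewrite h0; ring.
transitivity (y1 * (x1 * x2 + y1 * y2) + (x1 * y2 - y1 * x2) * x1).
  by ring.
by rewrite h0; ring.
Qed.

Lemma is_derive_eta1 s : I s ->
  is_derive s 1 (eta1 x y) (eta1' s).
Proof.
move=> Is; have [dx ddx _] := smooth_on_C2 x_smooth Is.
have [dy ddy _] := smooth_on_C2 y_smooth Is.
apply: (@near_eq_is_derive _ _ _
    (fun u => - (x u * derive1 x u + y u * derive1 y u))).
  by apply: (near_open I_open Is) => u /eta1E.
apply: (is_derive_eq (is_derive1N
  (is_derive1D (is_derive1M dx ddx) (is_derive1M dy ddy)))).
have [-> ->] := frenet Is; by rewrite /eta1' /eta2 -(arc_length Is); ring.
Qed.

Lemma is_derive_eta2 s : I s ->
  is_derive s 1 (eta2 x y) (- (k s * eta1 x y s)).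
Proof.
move=> Is; have [dx ddx _] := smooth_on_C2 x_smooth Is.
have [dy ddy _] := smooth_on_C2 y_smooth Is.
apply: (is_derive_eq (is_derive1D (is_derive1M dx ddy)
  (is_derive1N (is_derive1M dy ddx)))).
by have [-> ->] := frenet Is; rewrite eta1E//; ring.
Qed.

Lemma continuous_curve_curvature s : I s -> {for s, continuous k}.
Proof.
move=> Is; have [_ dx cx] := smooth_on_C2 x_smooth Is.
have [_ dy cy] := smooth_on_C2 y_smooth Is.
have cx1 := is_derive1_continuous dx; have cy1 := is_derive1_continuous dy.
apply: (continuous1D (continuous1M cx1 cy)).
exact/continuousN/(continuous1M cy1 cx).
Qed.

Lemma is_derive_area_factor s : I s ->
  is_derive s 1 W (omega ^+ 2 * eta1 x y s * eta1' s / W s).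
Proof.
move=> Is; have de := is_derive_eta1 Is.
have h : 0 < 1 + omega ^+ 2 * eta1 x y s ^+ 2 by nra.
have W0 := area_factor_gt0 omega x y s.
apply: (is_derive_eq (is_derive1_sqrt_comp
  (f := fun u => 1 + omega ^+ 2 * eta1 x y u ^+ 2) h
  (is_derive1D (is_derive1_cst (1 : R) s)
    (is_derive1M (is_derive1_cst (omega ^+ 2) s) (is_derive1_sqr de))))).
by rewrite -/(area_factor omega x y s) -/(W s) in W0 *; field; rewrite gt_eqF.
Qed.

Lemma is_derive_nu3 s : I s -> is_derive s 1 t (omega * eta1' s / W s ^+ 3).
Proof.
move=> Is; have de := is_derive_eta1 Is; have dW := is_derive_area_factor Is.
have W0 := area_factor_gt0 omega x y s.
have W2 := area_factor_sqr omega x y s; rewrite -/(W s) in W0 W2.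
apply: (is_derive_eq (is_derive1M (is_derive1M (is_derive1_cst omega s) de)
  (is_derive1_inv (lt0r_neq0 W0) dW))).
move: (W s) (eta1' s) (eta1 x y s) W0 W2 => w e' e w0 w2.
transitivity (omega * e' * (w ^+ 2 - omega ^+ 2 * e ^+ 2) / w ^+ 3).
  by field; rewrite gt_eqF.
by rewrite w2; congr (_ / _); ring.
Qed.

(** * The anisotropic mean curvature *)

Lemma is_derive_co (th : R) : is_derive th 1 co (omega * si th).
Proof.
have did := is_derive1_id th.
have := is_derive1_chain (f := fun u => - (omega * u))
  (is_derive_cos (- (omega * th)))
  (is_derive1N (is_derive1M (is_derive1_cst omega th) did)).
by move=> /is_derive_eq; apply; rewrite /si; ring.
Qed.

Lemma is_derive_si (th : R) : is_derive th 1 si (- (omega * co th)).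
Proof.
have did := is_derive1_id th.
have := is_derive1_chain (f := fun u => - (omega * u))
  (is_derive_sin (- (omega * th)))
  (is_derive1N (is_derive1M (is_derive1_cst omega th) did)).
by move=> /is_derive_eq; apply; rewrite /co; ring.
Qed.

Lemma co_si th : co th ^+ 2 + si th ^+ 2 = 1.
Proof. exact: cos2Dsin2. Qed.

Lemma helicoidal_normalE s th : n s th =
  vec3 (((W s)^-1 * (derive1 x s * si th + derive1 y s * co th))
        +i* (- ((W s)^-1 * (derive1 x s * co th - derive1 y s * si th))))%C
    (t s).
Proof.
by apply: row3P; rewrite vec3E !mxE/= /t /nu3 /W /co /si; ring.
Qed.

Lemma dot_normal s th : I s -> dot (n s th) (n s th) = 1.
Proof.
move=> Is; rewrite helicoidal_normalE dot_vec3 /t /nu3 -/(W s).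
have := area_factor_gt0 omega x y s; have := area_factor_sqr omega x y s.
rewrite -/(W s); have := arc_length Is; have := co_si th.
move: (derive1 x s) (derive1 y s) (co th) (si th) (W s) (eta1 x y s).
move=> x1 y1 c d w e cd al w2 w0.
transitivity (w ^- 2 * ((x1 ^+ 2 + y1 ^+ 2) * (c ^+ 2 + d ^+ 2)
  + omega ^+ 2 * e ^+ 2)).
  by field; rewrite gt_eqF.
by rewrite cd al mulr1 -w2 mulVf// expf_neq0// gt_eqF.
Qed.

(** The gradient of the extension at the normal is [rho * n + g' * e_3]; written
out, it has the component [rho / W] along the horizontal normal, which is the
form required by [surface_div_frame]. *)
Lemma cahn_hoffmanE s th : I s -> cahn_hoffman gamma n s th =
  let p := rho (t s) * (W s)^-1 in
  vec3 ((p * (derive1 x s * si th + derive1 y s * co th))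
        +i* (- (p * (derive1 x s * co th - derive1 y s * si th))))%C
    (rho (t s) * t s + derive1 g (t s)).
Proof.
move=> Is; have t1 := nu3_itv omega x y s.
have [dg _ _] := profile_C2 gamma_smooth gamma_axial t1.
have n3 : n s th 0 ord_max = t s by rewrite helicoidal_normalE vec3E.
have := @grad_homog_ext _ gamma g (n s th) (derive1 g (t s)) gamma_axial.
rewrite n3 => /(_ dg (dot_normal th Is)); rewrite /cahn_hoffman => ->.
rewrite -radius2E helicoidal_normalE -/rho; apply: row3P; rewrite !mxE/=; ring.
Qed.

Lemma is_derive_rho (u : R) : -1 < u < 1 ->
  is_derive u 1 rho (- (u * derive1 (derive1 g) u)).
Proof.
move=> u1; have [dg ddg _] := profile_C2 gamma_smooth gamma_axial u1.
have did := is_derive1_id u.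
rewrite /rho (_ : radius2 g = fun v => g v - v * derive1 g v); last first.
  by apply/funext => v; exact: radius2E.
apply: (is_derive_eq (is_derive1D dg (is_derive1N (is_derive1M did ddg)))).
ring.
Qed.

Lemma is_derive_rho_area (s : R) : I s ->
  is_derive s 1 (fun u => rho (t u) * (W u)^-1)
    (- (omega ^+ 2 * eta1 x y s * eta1' s * b s) / W s ^+ 5).
Proof.
move=> Is; have t1 := nu3_itv omega x y s.
have dt := is_derive_nu3 Is; have dW := is_derive_area_factor Is.
have W0 := area_factor_gt0 omega x y s.
apply: (is_derive_eq (is_derive1M (is_derive1_chain (is_derive_rho t1) dt)
  (is_derive1_inv (lt0r_neq0 W0) dW))).
rewrite /b -/(eta1' s) /t -/(W s) {1}/nu3 -/(W s); field.
by rewrite gt_eqF.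
Qed.

Lemma is_derive_height (s : R) : I s ->
  is_derive s 1 (fun u => rho (t u) * t u + derive1 g (t u))
    (((1 - t s ^+ 2) * derive1 (derive1 g) (t s) + rho (t s))
      * (omega * eta1' s / W s ^+ 3)).
Proof.
move=> Is; have t1 := nu3_itv omega x y s.
have [_ ddg _] := profile_C2 gamma_smooth gamma_axial t1.
have dt := is_derive_nu3 Is.
apply: (is_derive_eq (is_derive1D
  (is_derive1M (is_derive1_chain (is_derive_rho t1) dt) dt)
  (is_derive1_chain ddg dt))).
rewrite -/(eta1' s) -/(W s) -/(t s); ring.
Qed.

(** As [1 - t ^+ 2 = 1 / W ^+ 2], the quantity [b] is [W ^+ 2 / mu1]: the two
terms carry the two principal radii of curvature of the Wulff shape. *)
Definition mean_curvature_profile (s : R) : R :=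
  - (k s * (rho (t s) * (W s)^-1)
     + omega ^+ 2 * eta2 x y s * eta1' s * b s / W s ^+ 5).

(** In the frame turned by [- omega * th], the pair [(m, l)] of
[surface_div_frame] is the velocity of the plane curve and [(z1, z2)] its
position, so that [- (z1 * m + z2 * l)] and [z1 * l - z2 * m] are [eta1] and
[eta2], and the frame turns at the rate [k] by the Frenet equations. *)
Lemma aniso_mean_curvature_helicoidal (s th : R) : I s ->
  aniso_mean_curvature gamma (helicoidal omega C x y) n s th
  = mean_curvature_profile s.
Proof.
move=> Is; have [dx ddx _] := smooth_on_C2 x_smooth Is.
have [dy ddy _] := smooth_on_C2 y_smooth Is.
have dc := is_derive_co th; have ds := is_derive_si th.
have C' := fun q : R => is_derive1_cst q th.
have S' := fun q : R => is_derive1_cst q s.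
have dp := is_derive_rho_area Is; have dq := is_derive_height Is.
have [x2E y2E] := frenet Is.
pose p u := rho (t u) * (W u)^-1.
pose q u := rho (t u) * t u + derive1 g (t u).
set p' := (X in is_derive _ _ _ X) in dp.
set q' := (X in is_derive _ _ _ X) in dq.
pose m := derive1 x s * co th - derive1 y s * si th.
pose l := derive1 x s * si th + derive1 y s * co th.
pose z1 := x s * co th - y s * si th; pose z2 := x s * si th + y s * co th.
have cs := co_si th.
have ml : m ^+ 2 + l ^+ 2 = 1.
  transitivity ((derive1 x s ^+ 2 + derive1 y s ^+ 2)
    * (co th ^+ 2 + si th ^+ 2)); first by rewrite /m /l; ring.
  by rewrite arc_length// cs mulr1.
have e1E : - (z1 * m + z2 * l) = eta1 x y s.
  rewrite eta1E// -[RHS]mulr1 -cs /z1 /z2 /m /l; ring.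
have e2E : z1 * l - z2 * m = eta2 x y s.
  by rewrite /eta2 -[RHS]mulr1 -cs /z1 /z2 /m /l; ring.
have dX_s : is_derive s 1 (fun u => helicoidal omega C x y u th)
    (vec3 (m +i* l)%C 0).
  apply: (is_derive_eq (is_derive_vec3
    (is_derive1D (is_derive1M dx (S' (co th)))
      (is_derive1N (is_derive1M dy (S' (si th)))))
    (is_derive1D (is_derive1M dx (S' (si th))) (is_derive1M dy (S' (co th))))
    (S' (th + C)))).
  by apply: vec3_eq => //; rewrite /m /l; ring.
have dX_th : is_derive th 1 (helicoidal omega C x y s)
    (vec3 ((omega * z2) +i* (- (omega * z1)))%C 1).
  apply: (is_derive_eq (is_derive_vec3
    (is_derive1D (is_derive1M (C' (x s)) dc)
      (is_derive1N (is_derive1M (C' (y s)) ds)))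
    (is_derive1D (is_derive1M (C' (x s)) ds) (is_derive1M (C' (y s)) dc))
    (is_derive1D (is_derive1_id th) (C' C)))).
  by apply: vec3_eq; rewrite /z1 /z2; ring.
have dxi_s : is_derive s 1 (fun u => cahn_hoffman gamma n u th)
    (vec3 ((p' * l + p s * k s * m) +i* (- (p' * m) + p s * k s * l))%C q').
  have xiE := near_open I_open Is (fun u Iu => esym (cahn_hoffmanE th Iu)).
  apply: (near_eq_is_derive xiE).
  apply: (is_derive_eq (is_derive_vec3
    (is_derive1M dp (is_derive1D (is_derive1M ddx (S' (si th)))
      (is_derive1M ddy (S' (co th)))))
    (is_derive1N (is_derive1M dp (is_derive1D (is_derive1M ddx (S' (co th)))
      (is_derive1N (is_derive1M ddy (S' (si th)))))))
    dq)).
  by apply: vec3_eq => //; rewrite x2E y2E -/(p s) /m /l; ring.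
have dxi_th : is_derive th 1 (cahn_hoffman gamma n s)
    (vec3 ((- (omega * p s * m)) +i* (- (omega * p s * l)))%C 0).
  have xiE : (fun v => cahn_hoffman gamma n s v) = _ :=
    funext (fun v => cahn_hoffmanE v Is).
  rewrite [cahn_hoffman gamma n s]xiE.
  apply: (is_derive_eq (is_derive_vec3
    (is_derive1M (C' (p s)) (is_derive1D (is_derive1M (C' (derive1 x s)) ds)
      (is_derive1M (C' (derive1 y s)) dc)))
    (is_derive1N (is_derive1M (C' (p s))
      (is_derive1D (is_derive1M (C' (derive1 x s)) dc)
        (is_derive1N (is_derive1M (C' (derive1 y s)) ds)))))
    (C' (q s)))).
  by apply: vec3_eq => //; rewrite /m /l; ring.
rewrite /aniso_mean_curvature (surface_div_frame ml dX_s dX_th dxi_s dxi_th).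
rewrite e1E e2E -area_factor_sqr -/W; congr (- (_ + _)).
have w0 := area_factor_gt0 omega x y s.
have w2 := area_factor_sqr omega x y s; rewrite -/W in w0 w2.
have tE : t s ^+ 2 = 1 - (W s ^+ 2)^-1.
  rewrite /t /nu3 -/W exprMn exprMn exprVn.
  have -> : omega ^+ 2 * eta1 x y s ^+ 2 = W s ^+ 2 - 1 by rewrite w2; ring.
  by field; rewrite gt_eqF.
rewrite /q' /p' tE /b.
move: (W s) (eta1' s) (derive1 (derive1 g) (t s)) (rho (t s)) (eta1 x y s)
  (eta2 x y s) w0 w2 => w e' g'' r e1 e2 w0 w2.
(* Both sides agree once omega^2 eta1^2 is replaced by W^2 - 1. *)
transitivity (omega ^+ 2 * e2 * e' / w ^+ 7
    * (g'' + r * w ^+ 2 + (omega ^+ 2 * e1 ^+ 2) * (g'' + r * w ^+ 2))).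
  by field; rewrite gt_eqF.
have -> : omega ^+ 2 * e1 ^+ 2 = w ^+ 2 - 1 by rewrite w2; ring.
by field; rewrite gt_eqF.
Qed.

(** * The first integral *)

Let H := mean_curvature_profile.

Lemma continuous_mean_curvature_profile s : I s -> {for s, continuous H}.
Proof.
move=> Is; have t1 := nu3_itv omega x y s.
have [_ _ cg] := profile_C2 gamma_smooth gamma_axial t1.
have ck := continuous_curve_curvature Is.
have cp := is_derive1_continuous (is_derive_rho_area Is).
have ct := is_derive1_continuous (is_derive_nu3 Is).
have ce := is_derive1_continuous (is_derive_eta2 Is).
have cW := is_derive1_continuous (is_derive_area_factor Is).
have crho := is_derive1_continuous (is_derive_rho t1).
have cgt := continuous_comp ct cg.
have crt := continuous_comp ct crho.
have c1 (a : R) : {for s, continuous (fun _ : R => a)} by exact: cst_continuous.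
have W0 : W s ^+ 5 != 0.
  by rewrite expf_neq0// gt_eqF// area_factor_gt0.
have cW2 : {for s, continuous (fun u => W u ^+ 2)}.
  exact: (continuous1M cW cW).
have cW5 : {for s, continuous (fun u => W u ^+ 5)}.
  exact: (continuous1M cW
    (continuous1M cW (continuous1M cW (continuous1M cW cW)))).
have h1 := continuous1M ck cp.
have h2 := continuous1M (c1 (omega ^+ 2)) ce.
have h3 := continuous1D (continuous1M ck ce) (c1 (- 1)).
have h4 := continuous1D cgt (continuous1M crt cW2).
have h5 : {for s, continuous (fun u => (W u ^+ 5)^-1)}.
  by apply: cvgV => //; exact: cW5.
have h6 := continuous1M (continuous1M (continuous1M h2 h3) h4) h5.
exact: (continuousN (continuous1D h1 h6)).
Qed.

Definition first_integral_density (Lambda s : R) : R :=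
  Lambda * (eta1 x y s ^+ 2 + eta2 x y s ^+ 2)
  + 2 * eta2 x y s * (rho (t s) * (W s)^-1).

(** Every term of the derivative has [eta1] as a factor, since
[(eta1^2 + eta2^2)' = - 2 eta1], [eta2' = - k eta1], and the derivative of
[rho / W] is a multiple of [eta1]. *)
Lemma is_derive_first_integral_density Lambda s : I s ->
  is_derive s 1 (first_integral_density Lambda)
    (- (2 * eta1 x y s * (Lambda - H s))).
Proof.
move=> Is; have dp := is_derive_rho_area Is.
have d1 := is_derive_eta1 Is; have d2 := is_derive_eta2 Is.
apply: (is_derive_eq (is_derive1D (is_derive1M (is_derive1_cst Lambda s)
  (is_derive1D (is_derive1_sqr d1) (is_derive1_sqr d2)))
  (is_derive1M (is_derive1M (is_derive1_cst (2 : R) s) d2) dp))).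
by rewrite /H /mean_curvature_profile /eta1'; ring.
Qed.

(** Where [eta1] vanishes the curve is an arc of a circle centred at the origin
and the surface is a piece of a cylinder: [eta2] is locally constant and
[k * eta2 = 1]. *)
Lemma mean_curvature_profile_locally_cst s : I s ->
  (\forall u \near s, eta1 x y u = 0) -> \forall u \near s, H u = H s.
Proof.
move=> Is e0.
have : \forall u \near s, I u /\ eta1 x y u = 0.
  by apply: filterI => //; exact: open_nbhs_nbhs.
move=> /nbhs_ballP[r /= r0 br].
pose J := ball s r.
have Jint : is_interval J by rewrite /J ball_itv; exact: interval_is_interval.
have JI u : J u -> I u by move=> /br[].
have Je u : J u -> eta1 x y u = 0 by move=> /br[].
have kE u : J u -> k u * eta2 x y u = 1.
  move=> Ju; have d1 := is_derive_eta1 (JI u Ju).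
  have d1' : is_derive u 1 (eta1 x y) 0.
    apply: (@near_eq_is_derive _ _ _ (cst (0 : R))).
      have : \forall v \near u, J v.
        by apply: open_nbhs_nbhs; split => //; exact: ball_open.
      by apply: filterS => v /Je.
  apply/eqP; rewrite -subr_eq0 -/(eta1' u) -(is_derive1_val d1).
  by rewrite (is_derive1_val d1').
have eE u : J u -> eta2 x y u = eta2 x y s.
  move=> Ju; apply: (@cst_on_interval _ J) => //; last exact: ballxx.
  move=> v Jv; have d2 := is_derive_eta2 (JI v Jv).
  by apply: (is_derive_eq d2); rewrite Je// mulr0 oppr0.
have Js : J s by exact: ballxx.
have HE u : J u -> H u = - (k u * (rho 0 * (Num.sqrt 1)^-1)).
  move=> Ju; rewrite /H /mean_curvature_profile /eta1' kE// /t /nu3 /W.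
  rewrite /area_factor Je// expr0n/= !mulr0 addr0 mul0r subrr mulr0 !mul0r.
  by rewrite addr0.
have e20 : eta2 x y s != 0.
  apply/eqP => e20; have := kE _ Js.
  by rewrite e20 mulr0 => /esym/eqP; rewrite oner_eq0.
have kk u : J u -> k u = k s.
  move=> Ju; apply: (mulIf e20); transitivity (1 : R); last exact/esym/kE.
  by rewrite -(eE u Ju); exact: kE.
have nJ : \forall u \near s, J u by exact: nbhsx_ballx.
by apply: filterS nJ => u Ju; rewrite (HE u Ju) (HE s Js) (kk u Ju).
Qed.

End helicoidal_surface.

Unset Implicit Arguments.
Set Strict Implicit.

Theorem theorem3p1 (R : realType) (gamma : 'rV[R]_3 -> R) (g : R -> R)
    (gamma_density : anisotropic_density gamma)
    (gamma_axial : axially_symmetric gamma g)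
    (omega C : R) (I : set R) (I_open : open I) (I_interval : is_interval I)
    (x y : R -> R) (x_smooth : smooth_on I x) (y_smooth : smooth_on I y)
    (arc_length : forall s, I s -> derive1 x s ^+ 2 + derive1 y s ^+ 2 = 1)
    (Lambda : R) :
  let constant_curvature :=
    forall s t, I s ->
      aniso_mean_curvature gamma (helicoidal omega C x y)
        (helicoidal_normal omega x y) s t = Lambda in
  let first_integral :=
    exists A : R, forall s, I s ->
      Lambda * (eta1 x y s ^+ 2 + eta2 x y s ^+ 2)
      + 2 * eta2 x y s
        / (mu2 g (omega * eta1 x y s
                  / Num.sqrt (1 + omega ^+ 2 * eta1 x y s ^+ 2))
           * Num.sqrt (1 + omega ^+ 2 * eta1 x y s ^+ 2))
      + A = 0 in
  (constant_curvature -> first_integral) /\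
  ((exists2 s, I s & eta1 x y s != 0) ->
     first_integral -> constant_curvature).
Proof.
move=> constant_curvature first_integral.
have [gamma_smooth _ _] := gamma_density.
set Phi := first_integral_density g omega x y Lambda.
set H := mean_curvature_profile g omega x y.
have HE s t (Is : I s) := aniso_mean_curvature_helicoidal
  gamma_smooth gamma_axial omega C I_open x_smooth y_smooth arc_length t Is.
have PhiE s : Phi s = Lambda * (eta1 x y s ^+ 2 + eta2 x y s ^+ 2)
      + 2 * eta2 x y s
        / (mu2 g (omega * eta1 x y s
                  / Num.sqrt (1 + omega ^+ 2 * eta1 x y s ^+ 2))
           * Num.sqrt (1 + omega ^+ 2 * eta1 x y s ^+ 2)).
  by rewrite /Phi /first_integral_density /radius2 -invfM.
have dPhi s (Is : I s) :
    is_derive s 1 Phi (- (2 * eta1 x y s * (Lambda - H s))).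
  exact: (is_derive_first_integral_density gamma_smooth gamma_axial omega
    I_open x_smooth y_smooth arc_length Lambda Is).
split=> [cc|[s1 Is1 e1] [A fi] s t Is].
  have [[s0 Is0]|noI] := pselect (exists s, I s); last first.
    by exists 0 => s Is; case: noI; exists s.
  have dPhi0 s (Is : I s) : is_derive s 1 Phi 0.
    have Hs : H s = Lambda by rewrite /H -(HE s 0 Is); exact: cc.
    by apply: (is_derive_eq (dPhi s Is)); rewrite Hs subrr mulr0 oppr0.
  exists (- Phi s0) => s Is.
  by rewrite -PhiE (cst_on_interval I_interval dPhi0 Is Is0) subrr.
have etaH u : I u -> eta1 x y u * (Lambda - H u) = 0.
  move=> Iu; have /is_derive1_val := dPhi u Iu.
  have -> : derive1 Phi u = 0.
    rewrite derive1E (@near_eq_derive _ _ _ _ (cst (- A))) ?derive_cst//.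
    apply: (near_open I_open Iu) => v Iv.
    by apply/eqP; rewrite -subr_eq0 opprK PhiE; apply/eqP/fi.
  by move=> /esym/eqP; rewrite oppr_eq0 -mulrA mulf_eq0 pnatr_eq0/= => /eqP.
have cH u (Iu : I u) : {for u, continuous H}.
  exact: (continuous_mean_curvature_profile gamma_smooth gamma_axial I_open
    x_smooth y_smooth arc_length Iu).
rewrite HE// -/H; apply/eqP; apply: contrapT => /negP HsL.
(* If H s <> Lambda, then near a point where H takes the value H s it differs
   from Lambda, which forces eta1 = 0, hence H locally constant. *)
have Hs1 : H s1 = H s.
  apply: (locally_cst_on_interval I_interval Is cH) => // u Iu Hu.
  rewrite -Hu in HsL *; have HuL := continuous_near_neq (cH u Iu) HsL.
  apply: (mean_curvature_profile_locally_cst g omega I_open x_smooth y_smooth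
    arc_length Iu).
  apply: filterS2 HuL (open_nbhs_nbhs (conj I_open Iu)) => v HvL Iv.
  have /eqP := etaH v Iv; rewrite mulf_eq0 => /orP[/eqP//|].
  by rewrite subr_eq0 eq_sym (negbTE HvL).
have /eqP := etaH s1 Is1; rewrite mulf_eq0 (negbTE e1)/= Hs1 subr_eq0 eq_sym.
by rewrite (negbTE HsL).
Qed.
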